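(* Let $(\mathcal F_n,\int^{x_n})$ be a Rota-Baxter hierarchy over a field $K$ and let $\mathcal G$ be an admissible coefficient domain for $\mathcal F$. Let $1\le i<j\le n$, let $v\in K^{n-i}$, $w\in K^{n-j}$ and $g,h\in\mathcal G_1$. Then $$\int^{x_j}h(x_j)\,L_j(w)^*\int^{x_i}g(x_i)\,L_i(v)^*=(1-E_j^* )\int^{x_i}\eta'_\mu\,L_i(v')^*\int^{x_j}\eta_\mu\,L_j(w)^*$$ (summation over $\mu$ implied), where $v=(v_{i+1},\dots,v_n)^\top$, $w=(w_{j+1},\dots,w_n)^\top$, $$v'=L_{j-i}^{-1}(w)\,v=(v_{i+1},\dots,v_j,\,v_{j+1}-w_{j+1}v_j,\dots,v_n-w_nv_j)^{\top}\in K^{n-i},$$ $\eta'=g(x_i)\,\tilde h\{i\}$, $\eta=\tilde h\{j\}$ and $\tilde h=h[e_j-v_je_i]\in\mathcal G_{(i,j)}$.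
   Context: $K$ is a field of characteristic zero. All $K$-algebras are commutative and unital; all bialgebras are commutative and cocommutative. Rota-Baxter operators have weight zero: a linear operator $P$ with $P(u)P(v)=P(uP(v))+P(P(u)v)$. A Rota-Baxter algebra $(G,P)$ over a ring $R\supseteq\mathbb Q$ ($P$ being $R$-linear) is ordinary if $P$ is injective and $G=R\oplus\operatorname{im}P$ as $R$-modules; its associated evaluation is the projector onto $R$ along $\operatorname{im}P$. Matrices. $\mathcal M(K)$ is the monoid of infinite matrices (indexed by $1,2,\dots$) of the form $I+\tilde M$ with $\tilde M$ having finitely many nonzero rows and columns; $M\in\mathcal M_n(K)=K^{n\times n}$ is identified with $\mathrm{diag}(M,I)$. $\tilde{\mathcal M}_m(K)=\{\mathrm{diag}(I_m,M): M\in\mathcal M(K)\}$. $E_n:=I-e_{nn}$. A scalar $\lambda$ is identified with $\mathrm{diag}(\lambda,1,1,\dots)$; a row $a=(a_1,\dots,a_n)$ is identified with the matrix having first row $a$ and all further rows equal to those of $I$. $T_1(e_1):=I+e_{12}$. For $w=(w_{i+1},\dots,w_n)^{\top}\in K^{n-i}$, $L_i(w):=I+\sum_{k>i}w_ke_{ki}$, so $L_i^{-1}(w)=L_i(-w)$; unit vectors $e_k\in K^{n-i}$ are numbered by position. For $w\in K^{n-j}$ and $i<j$, $L_{j-i}(w)$ acting on $K^{n-i}$ denotes the corresponding $(n-i)\times(n-i)$ matrix. For $M\in\mathcal M(K)$, $M_{\lrcorner n}$ has the same first $n$ rows as $M$ and further rows $e_{n+1},e_{n+2},\dots$. $K$-hierarchy.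 An ascending sequence of $K$-algebras $K=\mathcal F_0\subseteq\mathcal F_1\subseteq\cdots$ with union $\mathcal F$, together with a contravariant monoid action of $\mathcal M(K)$ on $\mathcal F$ by $K$-algebra endomorphisms $M^*$ ($I^*=\mathrm{id}$, $(MN)^*=N^*M^*$) that is straight ($M^*f=M_{\lrcorner n}^*f$ for $f\in\mathcal F_n$) and satisfies $M^*(\mathcal F_n)\subseteq\mathcal F_n$ for $M\in\mathcal M_n(K)$ and $E_n^*(\mathcal F_n)\subseteq\mathcal F_{n-1}$. Rota-Baxter hierarchy. A $K$-hierarchy with commuting Rota-Baxter operators $\int^{x_n}:\mathcal F\to\mathcal F$ ($n\ge1$) such that: (a) for $n\le m$, $\int^{x_n}\mathcal F_m\subseteq\mathcal F_m$ and $\int^{x_n}M^*=M^*\int^{x_n}$ for all $M\in\tilde{\mathcal M}_m(K)$; (b) every $(\mathcal F_n,\int^{x_n})$ is an ordinary Rota-Baxter algebra over $\mathcal F_{n-1}$ with evaluation $E_n^*$; (c) $\tau^*\int^{x_i}=\int^{x_j}\tau^*$ for the transposition matrix $\tau=(i\;j)$; (d) for $\lambda\in K\setminus\{0\}$ and $v=(0,v')\in K\oplus K^{n-2}$: $\int^{x_1}\lambda^*=\lambda^{-1}\lambda^*\int^{x_1}$; $\int^{x_1}T_1(e_1)^*=(1-E_1^* )T_1(e_1)^*\int^{x_1}$; and $\int^{x_1}L_1(e_1+v)^*\int^{x_1}=L_2^{-1}(v')^*\,[L_1(e_1)^*,\int^{x_1}]\,\int^{x_2}L_2(v')^*$, where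 $[S,T]=ST-TS$. A Rota-Baxter subhierarchy consists of subalgebras $\mathcal G_n\subseteq\mathcal F_n$ forming a Rota-Baxter hierarchy under the restricted operators and the restricted matrix action. Scaled Rota-Baxter bialgebra. Let $(B,\Delta,\epsilon)$ be a $K$-bialgebra with product $\nabla$, unit $1$; put $\mathsf e:=1\circ\epsilon$ and $f\oplus g:=\nabla(f\otimes g)\Delta$ for linear endomorphisms. $(B,\Delta,\epsilon,\int)$ is a Rota-Baxter bialgebra if $(B,\int)$ is an ordinary Rota-Baxter algebra over $K$, $\mathsf e$ is the projector onto $K$ along $\operatorname{im}\int$, and $\Delta\int=(\int\otimes\mathrm{id})\Delta+(\mathsf e\otimes\mathrm{id})\Delta\int$. It is scaled if there is also a scaling $\lambda\mapsto\lambda^*$, i.e. a monoid homomorphism from $(K\setminus\{0\},\cdot)$ to bialgebra endomorphisms of $B$ such that, with $0^*:=\mathsf e$, $\lambda\mapsto\lambda^*$ is a semiring homomorphism $(K,+,\cdot)\to(\text{bialgebra endomorphisms},\oplus,\circ)$, and $\int\lambda^*=\lambda^{-1}\lambda^*\int$ for $\lambda\ne0$. Its induced Rota-Baxter hierarchy $\mathfrak H(B)$ has components $B_n=B^{\otimes n}$ (embedded in $B_{n+1}$ by $f\mapsto f\otimes1$), operators $\int^{x_n}=\mathrm{id}^{\otimes(n-1)}\otimes\int$, and matrix action $M^*(f_1\otimes\cdots\otimes f_n)=(M_{1\bullet}^*f_1)\cdots(M_{n\bullet}^*f_n)$, where $a^*:=(a_1^*\otimes\cdots\otimes a_n^* )\Delta^n:B\to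 B_n$ for a row $a$, and $\Delta^n$ is the iterated coproduct. Admissible coefficient domain. A Rota-Baxter hierarchy is separated if it is of the form $\mathfrak H(B)$ for a scaled Rota-Baxter bialgebra $B$. An admissible coefficient domain for $\mathcal F$ is a separated Rota-Baxter subhierarchy $\mathcal G=\mathfrak H(B)\le\mathcal F$; so $\mathcal G_1=B$, $\mathcal G_n=B^{\otimes n}$. Notation. $f[M]:=M^*(f)$, and $f[a]$ likewise for a row $a$. For $f\in\mathcal G_1$, $f(x_i):=(1\;i)^*f\in\mathcal G_{(i)}$, where $\mathcal G_{(i)}=(1\;i)^*\mathcal G_1$. For a finite set $\alpha$ of positive integers, $\mathcal G_\alpha$ (functions depending at most on the variables indexed by $\alpha$) is the subalgebra generated by the $\mathcal G_{(i)}$, $i\in\alpha$. Elements $f\in\mathcal F$ also denote the multiplication operators $u\mapsto fu$, and juxtaposition in operator expressions is composition. Tensor expansion: every $g\in\mathcal G_\alpha$ is written (via a fixed $K$-basis of $\mathcal G_1$, with scalars absorbed in one component) as $g=\sum_{\mu=1}^r\prod_{j\in\alpha}g\{j\}_\mu$ with $g\{j\}_\mu\in\mathcal G_{(j)}$. Products of a function with a sequence are componentwise. Summation over repeated Greek indices is implied. *)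

(* Defs.v *)
(* All indices are numbered from 0: the position k of a vector or a matrix,
   the variable x_k and the operator integ k correspond to index k + 1 in the
   convention where variables are x_1, x_2, ...; the component F_n of a
   hierarchy, which depends on n variables (now x_0, ..., x_(n-1)), keeps its
   number. *)
From HB Require Import structures.
From mathcomp Require Import all_boot all_order all_algebra finmap.
From mathcomp Require Import all_classical zify.

Set Implicit Arguments.
Unset Strict Implicit.
Unset Printing Implicit Defensive.

Import GRing.Theory.
Local Open Scope ring_scope.
Local Open Scope classical_set_scope.

(** * The monoid M(K) of infinite matrices *)

Section InfiniteMatrices.
Variable K : fieldType.

(* The identity matrix outside the upper left n x n corner. *)
Definition eq_id_from (n : nat) (M : nat -> nat -> K) : Prop :=
  forall i j, (n <= i)%N || (n <= j)%N -> M i j = (i == j)%:R.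

Record infmx := InfMx {
  infmx_entry :> nat -> nat -> K;
  infmx_stable : exists n, eq_id_from n infmx_entry }.

Lemma infmxP (M N : infmx) : (forall i j, M i j = N i j) -> M = N.
Proof.
case: M N => [M HM] [N HN] /= eqMN.
have e : M = N by apply/funext => i; apply/funext => j.
by subst N; congr InfMx; exact: Prop_irrelevance.
Qed.

Lemma idinf_stable : exists n, eq_id_from n (fun i j => (i == j)%:R).
Proof. by exists 0%N. Qed.

Definition idinf : infmx := InfMx idinf_stable.

(* The sum below has finite support; see mulinf_stable and mulinf_diag. *)
Definition mulinf_entry (M N : infmx) (i j : nat) : K :=
  \sum_(k \in [set: nat]) (M i k * N k j).

Lemma mulinf_entryE n (M N : infmx) i j :
  eq_id_from n M -> (i < n)%N ->
  mulinf_entry M N i j = \sum_(k < n) M i k * N k j.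
Proof.
move=> HM lt_in; rewrite /mulinf_entry -(fsbig_widen `I_n) //.
  by rewrite -(fsbig_ord _ _ (fun k => M i k * N k j)).
move=> k /= [_ /negP]; rewrite -leqNgt => le_nk.
rewrite HM ?le_nk ?orbT // [i == k]ltn_eqF ?mul0r //.
exact: leq_trans le_nk.
Qed.

Lemma eq_id_fromW n m M : (n <= m)%N -> eq_id_from n M -> eq_id_from m M.
Proof.
move=> le_nm HM i j /orP[] h; apply: HM.
  by rewrite (leq_trans le_nm h).
by rewrite (leq_trans le_nm h) orbT.
Qed.

Lemma mulinf_stable (M N : infmx) : exists n, eq_id_from n (mulinf_entry M N).
Proof.
have [m HM] := infmx_stable M; have [n HN] := infmx_stable N.
exists (maxn m n) => i j hij; pose p := maxn (maxn m n) i.+1.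
have HMp : eq_id_from p M by apply: eq_id_fromW HM; rewrite /p; lia.
rewrite (@mulinf_entryE p) //; last by rewrite /p; lia.
have lt_ip : (i < p)%N by rewrite /p; lia.
have [le_i|lt_i] := leqP (maxn m n) i.
  rewrite (bigD1 (Ordinal lt_ip)) //= big1 ?addr0 => [|k neq_k]; last first.
    rewrite HM; last by apply/orP; left; lia.
    by rewrite [i == k]eq_sym (negbTE (_ : val k != i)) ?mul0r.
  by rewrite HM ?HN ?eqxx ?mul1r //; lia.
have le_j : (maxn m n <= j)%N by move: hij; lia.
rewrite [RHS](_ : _ = 0); last by rewrite (_ : (i == j) = false) //; lia.
apply: big1 => k _; have [le_k|lt_k] := leqP (maxn m n) k.
  rewrite HM; last by lia.
  by rewrite (_ : (i == k) = false) ?mul0r //; lia.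
rewrite HN; last by lia.
by rewrite (_ : (nat_of_ord k == j) = false) ?mulr0 //; lia.
Qed.

Definition mulinf (M N : infmx) : infmx := InfMx (mulinf_stable M N).

(* diag(A, I) *)
Definition diag_entry (n : nat) (A : 'M[K]_n) (i j : nat) : K :=
  match insub i, insub j with
  | Some i', Some j' => A i' j'
  | _, _ => (i == j)%:R
  end.

Lemma diag_stable (n : nat) (A : 'M[K]_n) : exists m, eq_id_from m (diag_entry A).
Proof.
exists n => i j; rewrite /diag_entry; case: insubP => [i' _ <-|//].
by case: insubP => [j' _ <-|//]; rewrite !(leqNgt n) !ltn_ord.
Qed.

Definition diaginf (n : nat) (A : 'M[K]_n) : infmx := InfMx (diag_stable A).

(* diag(I_m, M) *)
Definition shift_entry (m : nat) (M : infmx) (i j : nat) : K :=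
  if (m <= i)%N && (m <= j)%N then M (i - m)%N (j - m)%N else (i == j)%:R.

Lemma shift_stable (m : nat) (M : infmx) : exists n, eq_id_from n (shift_entry m M).
Proof.
have [n HM] := infmx_stable M; exists (m + n)%N => i j hij.
rewrite /shift_entry; case: ifP => // /andP[le_i le_j].
by rewrite HM; [congr (_%:R); lia | lia].
Qed.

Definition shiftinf (m : nat) (M : infmx) : infmx := InfMx (shift_stable m M).

(* The first n rows of M, followed by those of the identity. *)
Definition corner_entry (n : nat) (M : infmx) (i j : nat) : K :=
  if (i < n)%N then M i j else (i == j)%:R.

Lemma corner_stable (n : nat) (M : infmx) : exists m, eq_id_from m (corner_entry n M).
Proof.
have [m HM] := infmx_stable M; exists m => i j hij.
by rewrite /corner_entry; case: ifP => // _; exact: HM.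
Qed.

Definition cornerinf (n : nat) (M : infmx) : infmx := InfMx (corner_stable n M).

(* I - e_nn *)
Lemma evalinf_stable (n : nat) :
  exists m, eq_id_from m (fun i j => ((i == j) && (i != n))%:R).
Proof. by exists n.+1 => i j hij; congr ((nat_of_bool _)%:R); lia. Qed.

Definition evalinf (n : nat) : infmx := InfMx (evalinf_stable n).

(* diag(l, 1, 1, ...) *)
Definition scal_entry (l : K) (i j : nat) : K :=
  if (i == 0%N) && (j == 0%N) then l else (i == j)%:R.

Lemma scal_stable l : exists m, eq_id_from m (scal_entry l).
Proof.
by exists 1%N => i j hij; rewrite /scal_entry; case: ifP => //; move: hij; lia.
Qed.

Definition scalinf (l : K) : infmx := InfMx (scal_stable l).

(* First row a, padded with zeros; the other rows are those of the identity. *)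
Definition row_entry (n : nat) (a : 'rV[K]_n) (i j : nat) : K :=
  if i == 0%N then (if insub j is Some j' then a 0 j' else 0)
  else (i == j)%:R.

Lemma row_stable (n : nat) (a : 'rV[K]_n) : exists m, eq_id_from m (row_entry a).
Proof.
exists n.+1 => i j hij; rewrite /row_entry; case: eqP => // i0.
case: insubP => [j' lt_j _|_]; first by move: hij; lia.
by rewrite (_ : (i == j) = false) //; lia.
Qed.

Definition rowinf (n : nat) (a : 'rV[K]_n) : infmx := InfMx (row_stable a).

(* The transposition of positions i and j. *)
Definition swap (i j k : nat) : nat :=
  if k == i then j else if k == j then i else k.

Lemma transp_stable (a b : nat) :
  exists m, eq_id_from m (fun i j => (swap a b i == j)%:R).
Proof.
exists (maxn a b).+1 => i j hij; congr ((nat_of_bool _)%:R).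
by rewrite /swap; case: (eqVneq i a); case: (eqVneq i b); move: hij; lia.
Qed.

Definition transpinf (a b : nat) : infmx := InfMx (transp_stable a b).

(* I + e_01, i.e. T_1(e_1) = I + e_12 when indices start at 1. *)
Definition T1_entry (i j : nat) : K :=
  (i == j)%:R + ((i == 0%N) && (j == 1%N))%:R.

Lemma T1_stable : exists m, eq_id_from m T1_entry.
Proof.
exists 2%N => i j hij; rewrite /T1_entry.
by rewrite (_ : (i == 0%N) && (j == 1%N) = false) ?addr0 //; lia.
Qed.

Definition T1inf : infmx := InfMx T1_stable.

(* The coordinate of w at position k, and 0 beyond the length of w. *)
Definition cventry (m : nat) (w : 'cV[K]_m) (k : nat) : K :=
  if insub k is Some k' then w k' 0 else 0.

(* L_i(w) = I + \sum_(k > i) w_k e_ki, where w_k sits at position k - i - 1. *)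
Definition L_entry (i m : nat) (w : 'cV[K]_m) (r c : nat) : K :=
  (r == c)%:R + (if (c == i) && (i < r)%N then cventry w (r - i.+1) else 0).

Lemma L_stable (i m : nat) (w : 'cV[K]_m) : exists n, eq_id_from n (L_entry i w).
Proof.
exists (i + m).+1 => r c hrc; rewrite /L_entry; case: ifP; rewrite ?addr0 //.
move=> hci; rewrite /cventry insubF ?addr0 //; lia.
Qed.

Definition Linf (i m : nat) (w : 'cV[K]_m) : infmx := InfMx (L_stable i w).

(* L_i^(-1)(w) *)
Definition Linvinf (i m : nat) (w : 'cV[K]_m) : infmx := Linf i (- w).

Definition truncinf (n : nat) (M : infmx) : 'M[K]_n := \matrix_(i, j) M i j.

(** Consistency of the encodings. *)

Lemma diag_entry_ord n (A : 'M[K]_n) (i j : 'I_n) : diag_entry A i j = A i j.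
Proof. by rewrite /diag_entry !valK. Qed.

Lemma mulinf_diag n (A B : 'M[K]_n) :
  mulinf (diaginf A) (diaginf B) = diaginf (A *m B).
Proof.
have Hd (C : 'M[K]_n) : eq_id_from n (diag_entry C).
  move=> i j; rewrite /diag_entry; case: insubP => [i' _ <-|//].
  by case: insubP => [j' _ <-|//]; rewrite !(leqNgt n) !ltn_ord.
apply: infmxP => i j /=; have [le_n|lt_n] := leqP n i.
  have HA : eq_id_from i.+1 (diaginf A) by apply: eq_id_fromW (Hd A); lia.
  rewrite (mulinf_entryE _ _ HA) //= (bigD1 ord_max) //=.
  rewrite (Hd A i i) ?le_n // (Hd B i j) ?le_n // eqxx mul1r.
  rewrite (Hd (A *m B) i j) ?le_n // big1 ?addr0 // => k neq_k.
  by rewrite (Hd A i k) ?le_n // [i == k]eq_sym (negbTE (_ : val k != i)) ?mul0r.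
rewrite (@mulinf_entryE n (diaginf A) _ _ _ (Hd A)) //.
have [le_j|lt_j] := leqP n j.
  rewrite (Hd (A *m B) i j) ?le_j ?orbT // [i == j]ltn_eqF; last by lia.
  apply: big1 => k _ /=; rewrite (Hd B k j) ?le_j ?orbT //.
  by rewrite [_ == j]ltn_eqF ?mulr0 //; have := ltn_ord k; lia.
rewrite (diag_entry_ord _ (Ordinal lt_n) (Ordinal lt_j)) mxE.
apply: eq_bigr => k _ /=; congr (_ * _).
  exact: (diag_entry_ord _ (Ordinal lt_n)).
exact: (diag_entry_ord _ _ (Ordinal lt_j)).
Qed.

Lemma mulinf_LK (i m : nat) (w : 'cV[K]_m) : mulinf (Linf i w) (Linvinf i w) = idinf.
Proof.
apply: infmxP => r c /=.
have [n0 H0] := infmx_stable (Linf i w).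
pose p := maxn n0 (maxn r i).+1.
have Hp : eq_id_from p (Linf i w) by apply: eq_id_fromW H0; rewrite /p; lia.
have lt_r : (r < p)%N by rewrite /p; lia.
have lt_i : (i < p)%N by rewrite /p; lia.
rewrite (@mulinf_entryE p) //= /L_entry.
have cvN k : cventry (- w) k = - cventry w k.
  by rewrite /cventry; case: insub => [k'|]; rewrite ?mxE ?oppr0.
have [lt_ir|le_ri] := ltnP i r; last first.
  rewrite (bigD1 (Ordinal lt_r)) //= eqxx andbF addr0 mul1r big1.
    by rewrite addr0 ltnNge le_ri andbF addr0.
  move=> k neq_k; rewrite andbF addr0 [r == k]eq_sym.
  by rewrite (negbTE (_ : val k != r)) ?mul0r.
rewrite (bigD1 (Ordinal lt_r)) //= (bigD1 (Ordinal lt_i)) /=; last first.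
  by rewrite -val_eqE /=; lia.
rewrite big1 ?addr0 => [|k /andP[nr ni]]; last first.
  rewrite [r == k]eq_sym (negbTE (_ : val k != r)) //.
  by rewrite (negbTE (_ : val k != i)) // addr0 mul0r.
rewrite !eqxx ltnn lt_ir andbF (gtn_eqF lt_ir) !andbT !cvN.
rewrite /= ?addr0 ?add0r ?mul1r.
rewrite [i == c]eq_sym; case: (c == i); rewrite ?mulr1 ?mulr0 ?addr0 //.
by rewrite subrK.
Qed.

End InfiniteMatrices.

(** * Ordinary Rota-Baxter algebras *)

Section OrdinaryRotaBaxter.
Variables (K : fieldType) (A : comAlgType K).

Definition scalars : set A := range (fun a : K => a%:A).

Definition subalgebra (S : set A) : Prop :=
  [/\ S 1,
      forall (a : K) u v, S u -> S v -> S (a *: u + v)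
    & forall u v, S u -> S v -> S (u * v)].

(* (G, P) is an ordinary Rota-Baxter algebra over R, for subalgebras R and G
   of A. *)
Record ordinary_RB (R G : set A) (P : A -> A) : Prop := OrdinaryRB {
  oRB_base : R `<=` G;
  oRB_stable : forall u, G u -> G (P u);
  oRB_linear : forall r u v, R r -> G u -> G v ->
    P (r * u + v) = r * P u + P v;
  oRB_axiom : forall u v, G u -> G v ->
    P u * P v = P (u * P v) + P (P u * v);
  oRB_inj : forall u v, G u -> G v -> P u = P v -> u = v;
  oRB_sum : forall u, G u -> exists r g, [/\ R r, G g & u = r + P g];
  oRB_direct : forall r g, R r -> G g -> r = P g -> r = 0 }.

(* E is the projector of G = R + im P onto R along im P. *)
Definition evaluation_of (R G : set A) (P E : A -> A) : Prop :=
  forall r g, R r -> G g -> E (r + P g) = r.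

End OrdinaryRotaBaxter.
Arguments scalars {K} A.

(** * Hierarchies *)

Section Hierarchies.
Variables (K : fieldType) (F : comAlgType K).
Variable C : nat -> set F.
Variable act : infmx K -> {lrmorphism F -> F}.
Variable integ : nat -> {linear F -> F}.

Definition total : set F := [set f | exists n, C n f].

(* The axioms are imposed on the union of the components C n only, so that
   they also express that the restrictions of act and integ to this union
   form a hierarchy. *)
Record hierarchy_axioms : Prop := HierarchyAxioms {
  hier_0 : C 0%N = scalars F;
  hier_subalgebra : forall n, subalgebra (C n);
  hier_ascending : forall n, C n `<=` C n.+1;
  hier_act_total : forall M f, total f -> total (act M f);
  hier_act1 : forall f, total f -> act (idinf K) f = f;
  hier_actM : forall M N f, total f -> act (mulinf M N) f = act N (act M f);
  hier_straight : forall n M f, C n f -> act M f = act (cornerinf n M) f;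
  hier_act_stable : forall n (M : 'M[K]_n) f, C n f -> C n (act (diaginf M) f);
  hier_eval : forall n f, C n.+1 f -> C n (act (evalinf K n) f) }.

Record RB_hierarchy_axioms : Prop := RBHierarchyAxioms {
  rbh_hierarchy : hierarchy_axioms;
  rbh_integ_total : forall k f, total f -> total (integ k f);
  rbh_RB : forall k u v, total u -> total v ->
    integ k u * integ k v = integ k (u * integ k v) + integ k (integ k u * v);
  rbh_comm : forall k l f, total f ->
    integ k (integ l f) = integ l (integ k f);
  rbh_stable : forall k m f, (k < m)%N -> C m f -> C m (integ k f);
  rbh_shift : forall k m (M : infmx K) f, (k < m)%N -> total f ->
    integ k (act (shiftinf m M) f) = act (shiftinf m M) (integ k f);
  rbh_ordinary : forall n, ordinary_RB (C n) (C n.+1) (integ n);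
  rbh_evaluation : forall n,
    evaluation_of (C n) (C n.+1) (integ n) (act (evalinf K n));
  rbh_transp : forall i j f, total f ->
    act (transpinf K i j) (integ i f) = integ j (act (transpinf K i j) f);
  rbh_scal : forall (l : K) f, l != 0 -> total f ->
    integ 0%N (act (scalinf l) f) = l^-1 *: act (scalinf l) (integ 0%N f);
  rbh_T1 : forall f, total f ->
    integ 0%N (act (T1inf K) f) =
    act (T1inf K) (integ 0%N f)
    - act (evalinf K 0) (act (T1inf K) (integ 0%N f));
  rbh_L : forall m (v' : 'cV[K]_m) f, total f ->
    let e1 : 'cV[K]_(1 + m) := delta_mx 0 0 in
    let v : 'cV[K]_(1 + m) := col_mx 0 v' in
    let commutator u :=
      act (Linf 0 e1) (integ 0%N u) - integ 0%N (act (Linf 0 e1) u) in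
    integ 0%N (act (Linf 0 (e1 + v)) (integ 0%N f)) =
    act (Linvinf 1 v') (commutator (integ 1%N (act (Linf 1 v') f))) }.

Definition RB_hierarchy : Prop := RB_hierarchy_axioms /\ total = setT.

End Hierarchies.

(** * Tensor powers *)

Definition tset n (T : Type) (t : n.-tuple T) (k : 'I_n) (x : T) : n.-tuple T :=
  [tuple if l == k then x else tnth t l | l < n].

Definition multilinear (K : fieldType) n (V W : lmodType K)
    (phi : n.-tuple V -> W) : Prop :=
  forall t k (a : K) x y,
    phi (tset t k (a *: x + y)) = a *: phi (tset t k x) + phi (tset t k y).

(* A choice of the tensor powers of an algebra over K, determined up to unique
   isomorphism by the universal property. On maps phi that are not multilinear
   tlift phi is an arbitrary map. *)
Record tensor_powers (K : fieldType) (B : comAlgType K) := TensorPowers {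
  tpow :> nat -> comAlgType K;
  tens : forall n, n.-tuple B -> tpow n;
  tlift : forall n (W : lmodType K), (n.-tuple B -> W) -> tpow n -> W;
  tens_multilinear : forall n, multilinear (@tens n);
  tens_one : forall n, tens [tuple 1 | l < n] = 1;
  tens_mul : forall n (s t : n.-tuple B),
    tens s * tens t = tens [tuple tnth s l * tnth t l | l < n];
  tlift_linear : forall n (W : lmodType K) (phi : n.-tuple B -> W),
    multilinear phi ->
    linear (tlift phi);
  tlift_tens : forall n (W : lmodType K) (phi : n.-tuple B -> W),
    multilinear phi ->
    forall t, tlift phi (tens t) = phi t;
  tlift_unique : forall n (W : lmodType K) (psi1 psi2 : {linear tpow n -> W}),
    (forall t, psi1 (tens t) = psi2 (tens t)) -> psi1 =1 psi2 }.

Section TensorMaps.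
Variables (K : fieldType) (B : comAlgType K) (T : tensor_powers B).

(* The linear map on B (x) B induced by a bilinear map. *)
Definition tlift2 (W : lmodType K) (phi : B -> B -> W) : T 2 -> W :=
  tlift (fun t : 2.-tuple B => phi (tnth t 0) (tnth t 1)).

Definition tens2 (a b : B) : T 2 := tens T [tuple a; b].
Definition tens3 (a b c : B) : T 3 := tens T [tuple a; b; c].

Definition tmap2 (f g : B -> B) : T 2 -> T 2 :=
  tlift2 (fun a b => tens2 (f a) (g b)).

(* f_0 (x) ... (x) f_(n-1) *)
Definition tmap n (f : 'I_n -> B -> B) : T n -> T n :=
  tlift (fun t => tens T [tuple f l (tnth t l) | l < n]).

(* x |-> x (x) b *)
Definition trcons n (b : B) : T n -> T n.+1 :=
  tlift (fun t => tens T [tuple of rcons t b]).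

Definition nabla : T 2 -> B := tlift2 (fun a b => a * b).

End TensorMaps.
Arguments tmap2 {K B} T f g _.

(** * Scaled Rota-Baxter bialgebras *)

(* Commutative and cocommutative bialgebras. *)
Record bialgebra (K : fieldType) := Bialgebra {
  bi_alg :> comAlgType K;
  bi_tpow : tensor_powers bi_alg;
  Delta : {lrmorphism bi_alg -> bi_tpow 2};
  counit : {lrmorphism bi_alg -> K^o};
  Delta_coassoc : forall b,
    tlift2 (fun a c => tlift2 (fun a1 a2 => tens3 bi_tpow a1 a2 c) (Delta a))
      (Delta b) =
    tlift2 (fun a c => tlift2 (fun c1 c2 => tens3 bi_tpow a c1 c2) (Delta c))
      (Delta b);
  Delta_counitl : forall b, tlift2 (fun a c => counit a *: c) (Delta b) = b;
  Delta_counitr : forall b, tlift2 (fun a c => counit c *: a) (Delta b) = b;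
  Delta_cocomm : forall b,
    tlift2 (fun a c => tens2 bi_tpow c a) (Delta b) = Delta b }.

Section BialgebraOperations.
Variables (K : fieldType) (B : bialgebra K).
Local Notation T := (bi_tpow B).

Definition ee (b : B) : B := (counit B b : K)%:A.

Definition oplus (f g : B -> B) (b : B) : B :=
  nabla (tmap2 T f g (Delta B b)).

Definition bialgebra_endo (f : {lrmorphism B -> B}) : Prop :=
  (forall b, Delta B (f b) = tmap2 T f f (Delta B b)) /\
  (forall b, counit B (f b) = counit B b).

(* The iterated coproduct; it is counit for n = 0 (as tpow 0 = K) and the
   identity for n = 1, up to the canonical isomorphisms. *)
Fixpoint iter_Delta (n : nat) : B -> T n :=
  match n with
  | 0 => fun b => (counit B b : K)%:A
  | m.+1 => fun b =>
      tlift2 (fun a c => trcons c (iter_Delta m a)) (Delta B b)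
  end.

End BialgebraOperations.
Arguments ee {K B} b.

(* The scaling is extended to all of K by 0^* := ee (axiom scaling0). *)
Record scaled_RB_bialgebra (K : fieldType) := ScaledRBBialgebra {
  sb_bialg :> bialgebra K;
  sb_int : {linear sb_bialg -> sb_bialg};
  sb_ordinary : ordinary_RB (scalars sb_bialg) setT sb_int;
  sb_evaluation : evaluation_of (scalars sb_bialg) setT sb_int ee;
  sb_Delta_int : forall b,
    Delta sb_bialg (sb_int b) =
    tmap2 (bi_tpow sb_bialg) sb_int id (Delta sb_bialg b)
    + tmap2 (bi_tpow sb_bialg) ee id (Delta sb_bialg (sb_int b));
  scaling : K -> {lrmorphism sb_bialg -> sb_bialg};
  scaling_endo : forall l, bialgebra_endo (scaling l);
  scaling0 : forall b, scaling 0 b = ee b;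
  scaling1 : forall b, scaling 1 b = b;
  scalingM : forall l m b, scaling (l * m) b = scaling l (scaling m b);
  scalingD : forall l m b,
    scaling (l + m) b = oplus (scaling l) (scaling m) b;
  scaling_int : forall l b, l != 0 ->
    sb_int (scaling l b) = l^-1 *: scaling l (sb_int b) }.

(* a^* = (a_1^* (x) ... (x) a_n^* ) Delta^n for a row a *)
Definition row_star (K : fieldType) (B : scaled_RB_bialgebra K) n
    (a : 'rV[K]_n) (b : B) : bi_tpow B n :=
  tmap (fun l => scaling B (a 0 l)) (iter_Delta n b).

(** * Separated hierarchies and admissible coefficient domains *)

Section Admissible.
Variables (K : fieldType) (F : comAlgType K).
Variables (act : infmx K -> {lrmorphism F -> F}).
Variable integ : nat -> {linear F -> F}.

(* G, with the restrictions of act and integ, is the hierarchy induced by B,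
   each component G n being identified with the n-th tensor power of B by
   iota n. *)
Record induced_by (G : nat -> set F) (B : scaled_RB_bialgebra K)
    (iota : forall n, {lrmorphism bi_tpow B n -> F}) : Prop := InducedBy {
  ind_inj : forall n, injective (iota n);
  ind_image : forall n, range (iota n) = G n;
  ind_embed : forall n (t : n.-tuple B),
    iota n.+1 (tens (bi_tpow B) [tuple of rcons t 1]) =
    iota n (tens (bi_tpow B) t);
  (* the operator on the k-th factor; factors to its right come from the
     embeddings *)
  ind_integ : forall n (k : 'I_n) (t : n.-tuple B),
    integ k (iota n (tens (bi_tpow B) t)) =
    iota n (tens (bi_tpow B) (tset t k (sb_int B (tnth t k))));
  (* N is any length beyond which the first n rows of M vanish *)
  ind_act : forall n N (M : infmx K) (t : n.-tuple B),
    (forall r c, (r < n)%N -> (N <= c)%N -> M r c = 0) ->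
    act M (iota n (tens (bi_tpow B) t)) =
    \prod_(r < n) iota N (row_star (\row_(c < N) M r c) (tnth t r)) }.

Definition separated (G : nat -> set F) : Prop :=
  exists (B : scaled_RB_bialgebra K)
         (iota : forall n, {lrmorphism bi_tpow B n -> F}),
    induced_by G iota.

Definition RB_subhierarchy (Fn G : nat -> set F) : Prop :=
  (forall n, G n `<=` Fn n) /\ RB_hierarchy_axioms G act integ.

Definition admissible (Fn G : nat -> set F) : Prop :=
  RB_subhierarchy Fn G /\ separated G.

End Admissible.

(** * Functions of selected variables and tensor expansions *)

Section Variables.
Variables (K : fieldType) (F : comAlgType K).
Variables (act : infmx K -> {lrmorphism F -> F}) (G : nat -> set F).

(* f(x_i) *)
Definition at_var (i : nat) (f : F) : F := act (transpinf K 0 i) f.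

(* G_(i) *)
Definition Gvar (i : nat) : set F := at_var i @` G 1%N.

(* G_alpha, the subalgebra generated by the G_(i) for i in alpha *)
Definition Gvars (alpha : {fset nat}) : set F :=
  [set f | forall S : set F, subalgebra S ->
     (forall i, i \in alpha -> Gvar i `<=` S) -> S f].

(* g = \sum_mu \prod_(k in alpha) g{k}_mu, where c k mu stands for g{k}_mu *)
Definition tensor_expansion (alpha : {fset nat}) (g : F) (r : nat)
    (c : nat -> 'I_r -> F) : Prop :=
  (forall k mu, k \in alpha -> Gvar k (c k mu)) /\
  g = \sum_(mu < r) \prod_(k <- alpha) c k mu.

(* Expansions exist; without a component to absorb scalars (alpha = fset0) this
   would fail. *)
Lemma tensor_expansion_exists (alpha : {fset nat}) (g : F) :
  subalgebra (G 1%N) -> alpha != fset0 -> Gvars alpha g ->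
  exists r (c : nat -> 'I_r -> F), tensor_expansion alpha g c.
Proof.
move=> [G1 GZ GM] /fset0Pn[k0 k0a].
have V1 k : Gvar k 1 by exists 1 => //; rewrite /at_var rmorph1.
have VZ k a u : Gvar k u -> Gvar k (a *: u).
  move=> [f Gf <-]; exists (a *: f); last by rewrite /at_var linearZ.
  have G0 : G 1%N 0 by rewrite -(addNr 1) -scaleN1r; exact: GZ.
  by rewrite -[_ *: f]addr0; exact: GZ.
have VM k u v : Gvar k u -> Gvar k v -> Gvar k (u * v).
  by move=> [f Gf <-] [f' Gf' <-]; exists (f * f'); [exact: GM|exact: rmorphM].
pose S : set F := [set f | exists (I : finType) (c : nat -> I -> F),
  (forall k mu, k \in alpha -> Gvar k (c k mu)) /\
  f = \sum_mu \prod_(k <- alpha) c k mu].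
suff SS : subalgebra S /\ forall i, i \in alpha -> Gvar i `<=` S.
  case: SS => SS SV; move=> /(_ S SS SV) [I [c [Vc ->]]].
  exists #|I|, (fun k m => c k (enum_val m)); split=> [k m|]; first exact: Vc.
  by rewrite (reindex _ (onW_bij _ (@enum_val_bij I))) /=.
split; first split.
- exists unit, (fun _ _ => 1); split => //.
  by rewrite big_const card_unit /= big1 ?addr0.
- move=> a _ _ [I [c [Vc ->]]] [J [d [Vd ->]]].
  exists (I + J)%type, (fun k m => match m with
    | inl x => if k == k0 then a *: c k x else c k x | inr y => d k y end).
  split=> [k [x|y] ka|]; [by case: eqP => _; auto | by auto |].
  rewrite big_sumType /=; congr (_ + _); rewrite scaler_sumr.
  apply: eq_bigr => x _; rewrite !(big_fsetD1 k0 k0a) /= eqxx scalerAl.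
  congr (_ * _); rewrite !big_seq; apply: eq_bigr => k.
  by rewrite !inE => /andP[/negbTE-> _].
- move=> _ _ [I [c [Vc ->]]] [J [d [Vd ->]]].
  exists (I * J)%type, (fun k m => c k m.1 * d k m.2).
  split=> [k m ka|]; first by auto.
  rewrite big_distrlr /= pair_bigA /=.
  by apply: eq_bigr => m _; rewrite big_split.
move=> i ia f Vf; exists unit, (fun k _ => if k == i then f else 1).
split=> [k m _|]; first by case: eqP => [->|].
rewrite big_const card_unit /= addr0 (big_fsetD1 i ia) /= eqxx big_seq big1 ?mulr1 //.
by move=> k; rewrite !inE => /andP[/negbTE->].
Qed.

End Variables.

(* Main.v *)
Require Import Defs.
From HB Require Import structures.
From mathcomp Require Import all_boot all_order all_algebra finmap.
From mathcomp Require Import all_classical.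
From mathcomp Require Import zify ring.
Set Implicit Arguments.
Unset Strict Implicit.
Unset Printing Implicit Defensive.

Import GRing.Theory.
Local Open Scope ring_scope.
Local Open Scope classical_set_scope.

(** Write x_i for the i-th variable and E_j for the evaluation at x_j = 0.
The formula is Fubini's theorem followed by a translation of the inner
integral. Expanding the left-hand side with the operator commutations
available for i <> j gives
  int^(x_i) g(x_i) int^(x_j) h(x_j) (L_i(v) L_j(w))^* f,
because an operator int^(x_i) commutes with every M^* whose matrix M is trivial
in row and column i ([integ_act]), and with multiplication by every function
that does not depend on x_i ([integ_mull]). Conjugating L_i(v) by L_j(w) only
changes the vector, L_i(v) L_j(w) = L_j(w) L_i(v') ([Linf_conj]), so the
operator L_j(w)^* can be moved to the far right, and it remains to move
L_i(v')^* across int^(x_j). In the variable t + v_j x_i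
the integral over 0 <= t <= x_j runs from v_j x_i to x_j + v_j x_i, hence
  int^(x_j) L_i(v')^* = (1 - E_j^* ) L_i(v')^* int^(x_j),
which is [integ_shear]. It comes from the translation axiom for T_1(e_1): the
shear x_j |-> x_j + c x_i with c <> 0 is conjugate to x_0 |-> x_0 + x_1 by a
monomial matrix ([integ_transl]).

The factor h(x_j) stays inside int^(x_j) while L_i(v')^* moves out, so it must
be written as L_i(v')^* of something. That is what h' = h(x_j - v_j x_i) is
for: L_i(v')^* h' = h(x_j). A tensor expansion of h' separates the factors in
x_i, which L_i(v')^* fixes and which therefore may leave the integral, from
those in x_j. These steps form [line_integral_exchange].

That h' lies in G_(i,j) is where separatedness enters: h[(a, b)] belongs to
G_2, which is the tensor square of B, hence spanned by products of a function
of the first and a function of the second variable ([Gvars_act]). *)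

(** * Products in the monoid of infinite matrices *)

Section Rows.
Variable K : fieldType.
Implicit Types M N : infmx K.

(** The rows of shears, of monomial matrices and of the substitution of a linear
form in two variables have at most two nonzero entries. The case k = l covers
rows with a single one. *)
Lemma mulinf_row2 M N r k l (a b : K) :
  (forall c, M r c = a * (k == c)%:R + b * (l == c)%:R) ->
  forall c, mulinf M N r c = a * N k c + b * N l c.
Proof.
move=> Mr c; have [p0 Hp0] := infmx_stable M.
pose p := maxn (maxn p0 r.+1) (maxn k l).+1.
have Hp : eq_id_from p M by apply: eq_id_fromW Hp0; rewrite /p; lia.
have [ltk ltl] : (k < p)%N /\ (l < p)%N by rewrite /p; lia.
have pick q (x : K) : (q < p)%N ->
    \sum_(m < p) x * (q == m)%:R * N m c = x * N q c.
  move=> ltq; rewrite (bigD1 (Ordinal ltq)) //= eqxx mulr1 big1 ?addr0 // => m.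
  by rewrite -val_eqE /= eq_sym => /negbTE->; rewrite mulr0 mul0r.
rewrite /= (mulinf_entryE _ _ Hp); last by rewrite /p; lia.
rewrite -(pick k a ltk) -(pick l b ltl) -big_split /=.
by apply: eq_bigr => m _; rewrite Mr mulrDl.
Qed.

Lemma mulinf_row M N r k (a : K) :
  (forall c, M r c = a * (k == c)%:R) ->
  forall c, mulinf M N r c = a * N k c.
Proof.
move=> Mr c; rewrite (@mulinf_row2 _ _ _ k k a 0) ?mul0r ?addr0 //.
by move=> d; rewrite Mr mul0r addr0.
Qed.

Lemma mulinf_row_unit M N r k :
  (forall c, M r c = (k == c)%:R) -> forall c, mulinf M N r c = N k c.
Proof.
move=> Mr c; rewrite (@mulinf_row _ _ _ k 1) ?mul1r // => d.
by rewrite Mr mul1r.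
Qed.

Lemma mulinf_transp a b N r c :
  mulinf (transpinf K a b) N r c = N (swap a b r) c.
Proof. exact: mulinf_row_unit. Qed.

End Rows.

Lemma swapK a b : involutive (swap a b).
Proof. by move=> k; rewrite /swap; do !case: eqP => //; lia. Qed.

Lemma swapC a b k : swap a b k = swap b a k.
Proof. by rewrite /swap; do !case: eqP => //; lia. Qed.

Lemma swapl a b : swap a b a = b.
Proof. by rewrite /swap eqxx. Qed.

Lemma swapr a b : swap a b b = a.
Proof. by rewrite /swap eqxx; case: eqP. Qed.

Lemma swapP a b k : k != a -> k != b -> swap a b k = k.
Proof. by rewrite /swap => /negbTE-> /negbTE->. Qed.

Section Columns.
Variable K : fieldType.
Implicit Types M N : infmx K.

Lemma mulinf_col2 M N c k l (a b : K) :
  (forall r, N r c = (r == k)%:R * a + (r == l)%:R * b) ->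
  forall r, mulinf M N r c = M r k * a + M r l * b.
Proof.
move=> Nc r; have [p0 Hp0] := infmx_stable M.
pose p := maxn (maxn p0 r.+1) (maxn k l).+1.
have Hp : eq_id_from p M by apply: eq_id_fromW Hp0; rewrite /p; lia.
have [ltk ltl] : (k < p)%N /\ (l < p)%N by rewrite /p; lia.
have pick q (x : K) : (q < p)%N ->
    \sum_(m < p) M r m * ((m == q :> nat)%:R * x) = M r q * x.
  move=> ltq; rewrite (bigD1 (Ordinal ltq)) //= eqxx mul1r big1 ?addr0 // => m.
  by rewrite -val_eqE /= => /negbTE->; rewrite mul0r mulr0.
rewrite /= (mulinf_entryE _ _ Hp); last by rewrite /p; lia.
rewrite -(pick k a ltk) -(pick l b ltl) -big_split /=.
by apply: eq_bigr => m _; rewrite Nc mulrDr.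
Qed.

Lemma mulinf_col M N c k (a : K) :
  (forall r, N r c = (r == k)%:R * a) ->
  forall r, mulinf M N r c = M r k * a.
Proof.
move=> Nc r; rewrite (@mulinf_col2 _ _ _ k k a 0) ?mulr0 ?addr0 //.
by move=> d; rewrite Nc mulr0 addr0.
Qed.

Lemma mulr_transp M a b r c :
  mulinf M (transpinf K a b) r c = M r (swap a b c).
Proof.
rewrite (@mulinf_col _ _ _ (swap a b c) 1) ?mulr1 // => k /=.
by rewrite mulr1 -(inv_eq (swapK a b)).
Qed.

Lemma mulr_eval M q r c :
  mulinf M (evalinf K q) r c = M r c * (c != q)%:R.
Proof.
apply: mulinf_col => k /=; rewrite -natrM mulnb.
by case: (eqVneq k c) => [->|].
Qed.

Lemma transpK a b : mulinf (transpinf K a b) (transpinf K a b) = idinf K.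
Proof. by apply: infmxP => r c; rewrite mulinf_transp /= swapK. Qed.
Lemma transp_row a b c : transpinf K a b a c = (b == c)%:R.
Proof. by rewrite /= swapl. Qed.

Lemma transp_col a b r : transpinf K a b r b = (r == a)%:R.
Proof. by rewrite /= -(inj_eq (inv_inj (swapK a b))) swapK swapr. Qed.

End Columns.

Lemma monomial_stable (K : fieldType) n (d : nat -> K) s :
  (forall r, (n <= r)%N -> d r = 1) -> (forall r, (n <= r)%N -> s r = r) ->
  injective s -> exists n, eq_id_from n (fun r c => d r * (s r == c)%:R).
Proof.
move=> d1 s1 s_inj; exists n => r c; have [le_nr _|lt_rn /= le_nc] := leqP n r.
  by rewrite d1 // s1 // mul1r.
rewrite -[in LHS](s1 _ le_nc) (inj_eq s_inj) ltn_eqF ?mulr0 //; lia.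
Qed.

(** * Integration and substitution in a Rota-Baxter hierarchy *)

Section Hierarchy.
Variables (K : fieldType) (F : comAlgType K) (C : nat -> set F).
Variable act : infmx K -> {lrmorphism F -> F}.
Variable integ : nat -> {linear F -> F}.
Hypothesis HF : RB_hierarchy C act integ.
Implicit Types (M N : infmx K) (f u : F).

Let RB : RB_hierarchy_axioms C act integ := HF.1.
Let H : hierarchy_axioms C act := rbh_hierarchy RB.

Lemma totalP f : Defs.total C f. Proof. by rewrite HF.2. Qed.
Hint Resolve totalP : core.

Lemma component f : exists n, C n f.
Proof. by have [n] := totalP f; exists n. Qed.

Lemma componentW n m f : (n <= m)%N -> C n f -> C m f.
Proof.
move=> /subnKC <-; elim: (m - n)%N => [|k IH] Cf; first by rewrite addn0.
by rewrite addnS; apply: (hier_ascending H); exact: IH.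
Qed.

Lemma component0 n : C n 0.
Proof.
have [C1 lin _] := hier_subalgebra H n.
by rewrite -(addNr 1) -scaleN1r; exact: lin.
Qed.

Lemma act_mul M f u : act M (f * u) = act M f * act M u.
Proof. exact: rmorphM. Qed.

Lemma actM M N f : act N (act M f) = act (mulinf M N) f.
Proof. by rewrite (hier_actM H). Qed.

Lemma act_eq_rows n M N f : C n f ->
  (forall r c, (r < n)%N -> M r c = N r c) -> act M f = act N f.
Proof.
move=> Cf eqMN; rewrite (hier_straight H M Cf) (hier_straight H N Cf).
congr (act _ f); apply: infmxP => r c /=; rewrite /corner_entry.
by case: ifP; auto.
Qed.

Lemma act_stable n M f : eq_id_from n M -> C n f -> C n (act M f).
Proof.
move=> Mn Cf; rewrite (_ : M = diaginf (truncinf n M)).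
  exact: (hier_act_stable H).
apply: infmxP => r c /=; rewrite /diag_entry.
case: insubP => [r' _ <-|]; last by rewrite -leqNgt => le_nr; rewrite Mn ?le_nr.
case: insubP => [c' _ <-|]; first by rewrite mxE.
by rewrite -leqNgt => le_nc; rewrite Mn ?le_nc ?orbT.
Qed.

Lemma act_transp_stable n a b f : (a < n)%N -> (b < n)%N -> C n f ->
  C n (act (transpinf K a b) f).
Proof.
move=> lta ltb; apply: act_stable => r c hrc /=; congr (_%:R).
by rewrite /swap; do !case: eqP; lia.
Qed.

Lemma act_transpK a b : involutive (act (transpinf K a b)).
Proof. by move=> f; rewrite actM transpK (hier_act1 H). Qed.

(** The substitution M^* replaces x_a by x_b and lets x_b enter nowhere else,
so it renames the variable of integration. Moving a and b to position 0 by
transpositions turns M into a matrix diag(I_1, M'), for which the commutation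
with the first integral is an axiom. *)
Lemma integ_act a b M u :
  (forall c, M a c = (b == c)%:R) -> (forall r, M r b = (r == a)%:R) ->
  integ b (act M u) = act M (integ a u).
Proof.
move=> Ma Mb.
have [M0 M0E] : exists M0 : infmx K,
    forall r c, M0 r c = M (swap 0 a r) (swap 0 b c).
  exists (mulinf (mulinf (transpinf K 0 a) M) (transpinf K 0 b)) => r c.
  by rewrite mulr_transp mulinf_transp.
have N_stable : exists n, eq_id_from n (fun r c => M0 r.+1 c.+1).
  have [n Hn] := infmx_stable M0; exists n => r c hrc; rewrite Hn //.
  by apply/orP; move: hrc; lia.
have M0_shift : M0 = shiftinf 1 (InfMx N_stable).
  apply: infmxP => [[|r] [|c]] //=; rewrite /shift_entry ?M0E ?swapl ?swapl //=.
  - by rewrite Mb eqxx.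
  - by rewrite Ma; case: eqP => // e; have := swapK 0 b c.+1; rewrite -e swapr.
  - by rewrite Mb; case: eqP => // e; have := swapK 0 a r.+1; rewrite e swapr.
  - by rewrite !subn1.
have Mfact : M = mulinf (mulinf (transpinf K 0 a) M0) (transpinf K 0 b).
  by apply: infmxP => r c; rewrite mulr_transp mulinf_transp M0E !swapK.
rewrite Mfact -!actM -(rbh_transp RB) // M0_shift (rbh_shift RB) //.
have tC k : transpinf K k 0 = transpinf K 0 k.
  by apply: infmxP => r c /=; rewrite swapC.
by rewrite -[transpinf K 0 a]tC (rbh_transp RB).
Qed.

Lemma eval_act a b M u :
  (forall c, M a c = (b == c)%:R) -> (forall r, M r b = (r == a)%:R) ->
  act (evalinf K b) (act M u) = act M (act (evalinf K a) u).
Proof.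
move=> Ma Mb; rewrite !actM; congr (act _ u); apply: infmxP => r c.
rewrite mulr_eval.
rewrite (@mulinf_row _ _ _ r r (r != a)%:R) => [|d].
  have [->|ne] /= := eqVneq r a.
    by rewrite Ma mul0r -natrM mulnb eq_sym andbN.
  have [->|_] /= := eqVneq c b; last by rewrite mulr1 mul1r.
  by rewrite Mb (negbTE ne) !mulr0.
by rewrite /= andbC; case: (r != a); rewrite ?mul1r ?mul0r.
Qed.


(** Functions r that do not depend on x_i behave as constants for int^(x_i).
Linearity over r is an axiom only for an operator int^(x_n) acting on F_(n+1)
with r in F_n. For n beyond all variables involved, exchanging x_i and x_n
fixes r and reduces the claim to this case. *)
Lemma integ_mull i r u : act (evalinf K i) r = r ->
  integ i (r * u) = r * integ i u.
Proof.
move=> Er; have [[n0 Cr] [n1 Cu]] := (component r, component u).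
pose n := maxn (maxn n0 n1) i.+1.
have {}Cr : C n r by apply: componentW Cr; rewrite /n; lia.
have {}Cu : C n.+1 u by apply: componentW Cu; rewrite /n; lia.
have lt_in : (i < n)%N by rewrite /n; lia.
pose t := act (transpinf K i n).
have tr : t r = r.
  rewrite -[r in LHS]Er -[RHS]Er /t actM; apply: (act_eq_rows Cr) => k c ltk.
  rewrite mulr_transp /=; congr (_%:R).
  by rewrite /swap; do !case: eqP; lia.
have tK : involutive t by apply: act_transpK.
have tI x : integ n (t x) = t (integ i x) by rewrite /t (rbh_transp RB).
have tM : {morph t : x y / x * y} by exact: rmorphM.
have Ctu : C n.+1 (t u) by apply: act_transp_stable => //; lia.
have lin : integ n (r * t u) = r * integ n (t u).
  have := oRB_linear (rbh_ordinary RB n) Cr Ctu (component0 n.+1).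
  by rewrite linear0 !addr0.
by rewrite -[LHS]tK -tI !tM tr lin tM tr tI tK.
Qed.

(** The evaluation axiom gives this on F_(i+1); the exchange of x_i with a
variable beyond all those of u extends it to u. *)
Lemma eval_integ i u : act (evalinf K i) (integ i u) = 0.
Proof.
have [n0 Cu] := component u; pose n := maxn n0 i.+1.
have {}Cu : C n.+1 u by apply: componentW Cu; rewrite /n; lia.
pose M := transpinf K i n.
have CMu : C n.+1 (act M u) by apply: act_transp_stable => //; rewrite /n; lia.
have En := rbh_evaluation RB (component0 n) CMu.
rewrite add0r -(rbh_transp RB) // in En.
have tK := act_transpK i n.
rewrite -[LHS]tK -/M -(@eval_act i n) ?En ?linear0 // => k.
  exact: transp_row.
exact: transp_col.
Qed.


(** Translation x_j |-> x_j + c x_i. For c <> 0 the monomial substitution Q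
below sends x_0 to x_j and x_1 to c x_i, so that Q M = T_1(e_1) Q, and the
axiom for T_1(e_1) is transported along Q; since rescaling x_i does not affect
int^(x_j), the constant c does not appear in the formula. *)
Lemma integ_transl (i j : nat) (c : K) M u : i != j ->
  (forall k, M j k = (j == k)%:R + c * (i == k)%:R) ->
  (forall r k, r != j -> M r k = (r == k)%:R) ->
  integ j (act M u) =
  act M (integ j u) - act (evalinf K j) (act M (integ j u)).
Proof.
move=> ne_ij Mj Mr; have [c0|c0] := eqVneq c 0.
  have ->: M = idinf K.
    apply: infmxP => r k /=; have [->|ne] := eqVneq r j; last exact: Mr.
    by rewrite Mj c0 mul0r addr0.
  by rewrite !(hier_act1 H) // eval_integ subr0.
(* A permutation s of the indices with s 0 = j and s 1 = i. *)
pose i' := swap 0 j i.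
have i'0 : i' != 0%N.
  by rewrite /i' /swap; move: ne_ij; do !case: eqP => //; lia.
pose s k := swap 0 j (swap 1 i' k).
pose s' k := swap 1 i' (swap 0 j k).
have s'K : cancel s' s by move=> k; rewrite /s /s' !swapK.
have sK : cancel s s' by move=> k; rewrite /s /s' !swapK.
have s0 : s 0%N = j by rewrite /s (@swapP 1 i') ?swapl // eq_sym.
have s1 : s 1%N = i by rewrite /s swapl swapK.
pose d r : K := if r == 1%N then c else 1.
have d_neq0 r : d r != 0 by rewrite /d; case: ifP => //; rewrite oner_neq0.
pose n := (maxn i j).+2.
have s_id r : (n <= r)%N -> s r = r.
  by rewrite /s /i' /swap /n; do !case: eqP; lia.
have s'_id r : (n <= r)%N -> s' r = r.
  by move=> le_nr; rewrite -[in LHS](s_id _ le_nr).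
have d_id r : (n <= r)%N -> d r = 1 by rewrite /d /n; case: eqP => // ->; lia.
have Q_stable := monomial_stable d_id s_id (can_inj sK).
have Q'_stable :
    exists n, eq_id_from n (fun r k => (d (s' r))^-1 * (s' r == k)%:R).
  apply: (@monomial_stable _ n) (can_inj s'K) => // r le_nr.
  by rewrite s'_id // d_id // invr1.
pose Q := InfMx Q_stable; pose Q' := InfMx Q'_stable.
have Q0 k : Q 0%N k = (j == k)%:R by rewrite /= s0 /d mul1r.
have Qc r : Q r j = (r == 0%N)%:R.
  rewrite /= -s0 (inj_eq (can_inj sK)) /d.
  by case: r => [|r]; rewrite ?mul1r ?mulr0.
have QK : mulinf Q' Q = idinf K.
  apply: infmxP => r k.
  rewrite (@mulinf_row _ _ _ r (s' r) (d (s' r))^-1) => [|l //].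
  by rewrite /= mulKf // s'K.
have sne r : s r.+1 != j by rewrite -s0 (inj_eq (can_inj sK)).
have QM : mulinf Q M = mulinf (T1inf K) Q.
  apply: infmxP => r k.
  rewrite (@mulinf_row _ Q _ r (s r) (d r)) //.
  rewrite (@mulinf_row2 _ (T1inf K) _ r r 1 1 (r == 0%N)%:R).
    case: r => [|[|r]].
    - by rewrite s0 Mj /= s0 s1 /d eqxx /= !mul1r.
    - by rewrite Mr // mul0r addr0 mul1r.
    - by rewrite Mr // mul0r addr0 mul1r.
  move=> l; rewrite /= /T1_entry mul1r; congr (_ + _).
  by rewrite -natrM mulnb [l == _]eq_sym.
have -> : u = act Q (act Q' u) by rewrite actM QK (hier_act1 H).
rewrite (integ_act _ Q0 Qc) !actM QM -!actM (integ_act _ Q0 Qc).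
by rewrite (rbh_T1 RB) // linearB /= -(eval_act _ Q0 Qc).
Qed.

(** A matrix M with column j trivial and row j equal to e_j + c e_i factors as
M = A T, where A has row j trivial as well, so that A^* commutes with
int^(x_j), and T is the translation x_j |-> x_j + c x_i. *)
Lemma integ_shear (i j : nat) (c : K) M u : i != j ->
  (forall k, M j k = (j == k)%:R + c * (i == k)%:R) ->
  (forall r, M r j = (r == j)%:R) ->
  integ j (act M u) =
  act M (integ j u) - act (evalinf K j) (act M (integ j u)).
Proof.
move=> ne_ij Mj Mc.
have A_stable : exists n, eq_id_from n
    (fun r k => if r == j then (r == k)%:R else M r k).
  have [n Mn] := infmx_stable M; exists n => r k hrk.
  by case: ifP => // _; exact: Mn.
pose A := InfMx A_stable.
have T_stable : exists n, eq_id_from n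
    (fun r k => (r == k)%:R + c * ((r == j) && (i == k))%:R).
  exists (maxn i j).+1 => r k hrk.
  by rewrite (_ : _ && _ = false) ?mulr0 ?addr0 //; lia.
pose T := InfMx T_stable.
have Aj k : A j k = (j == k)%:R by rewrite /= eqxx.
have Ac r : A r j = (r == j)%:R by rewrite /= Mc; case: eqVneq.
have MAT : M = mulinf A T.
  apply: infmxP => r k; rewrite (@mulinf_col2 _ A T k k j 1 (c * (i == k)%:R)).
    rewrite Ac mulr1 /=; have [->|_] := eqVneq r j.
      by rewrite Mj mul1r.
    by rewrite mul0r addr0.
  by move=> l; rewrite /= mulr1 mulrCA -natrM mulnb.
have Tj k : T j k = (j == k)%:R + c * (i == k)%:R by rewrite /= eqxx.
have Tr r k : r != j -> T r k = (r == k)%:R.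
  by move=> /negbTE ne; rewrite /= ne mulr0 addr0.
rewrite MAT -!actM -(integ_act _ Aj Ac).
exact: integ_transl ne_ij Tj Tr.
Qed.


Lemma act_at_var k l M h : C 1%N h -> (forall c, M k c = (l == c)%:R) ->
  act M (at_var act k h) = at_var act l h.
Proof.
move=> Ch Mk; rewrite /at_var actM; apply: (act_eq_rows Ch) => -[|r] // c _.
by rewrite mulinf_transp swapl Mk transp_row.
Qed.

Lemma eval_at_var k l h : C 1%N h -> k != l ->
  act (evalinf K l) (at_var act k h) = at_var act k h.
Proof.
by move=> Ch ne_kl; apply: act_at_var => // c; rewrite /= ne_kl andbT.
Qed.

(** The exchange formula with L_i(v), L_i(v'), L_j(w) replaced by matrices V,
V', W of which only the commutation relation and rows and columns i, j matter,
and with g, h replaced by functions of which only their invariance under some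
substitutions matters. The functions p_mu and q_mu are the factors in x_i and
in x_j of h(x_j - v_j x_i). *)
Lemma line_integral_exchange (i j : nat) (c : K) V V' W r
    (p q : 'I_r -> F) g h f :
  i != j ->
  mulinf V W = mulinf W V' ->
  (forall k, V' j k = (j == k)%:R + c * (i == k)%:R) ->
  (forall k, V' k j = (k == j)%:R) ->
  (forall k, W i k = (i == k)%:R) -> (forall k, W k i = (k == i)%:R) ->
  act W g = g -> act (evalinf K j) g = g -> act (evalinf K i) h = h ->
  (forall mu, act (evalinf K j) (p mu) = p mu) ->
  \sum_mu p mu * act V' (q mu) = h ->
  integ j (h * act W (integ i (g * act V f))) =
  (idfun \- act (evalinf K j))
    (\sum_mu integ i (g * p mu * act V' (integ j (q mu * act W f)))).
Proof.
move=> ne_ij VW V'j V'c Wi Wc Wg Eg Eh Ep sum_pq.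
have Ei k : evalinf K j i k = (i == k)%:R by rewrite /= ne_ij andbT.
have Ec k : evalinf K j k i = (k == i)%:R.
  by rewrite /=; case: eqVneq => [->|]; rewrite ?ne_ij.
rewrite -(integ_act _ Wi Wc) act_mul Wg actM VW -actM; set u := act W f.
(* Fubini: both multipliers leave the integral that does not concern them. *)
rewrite -integ_mull // (rbh_comm RB) // mulrCA integ_mull //.
rewrite /= -linear_sum /= -(integ_act _ Ei Ec) -linearB /=; congr (integ i _).
rewrite linear_sum -sumrB -sum_pq mulr_suml linear_sum mulr_sumr /=.
apply: eq_bigr => mu _.
rewrite !act_mul Eg Ep -mulrA -[in RHS]mulrA -!mulrBr -mulrA integ_mull //.
by rewrite -(integ_shear _ ne_ij V'j V'c) act_mul.
Qed.

End Hierarchy.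

(** * The matrices L_i(v) *)

Section Shears.
Variable K : fieldType.

Lemma cventry_ord m (w : 'cV[K]_m) (k : 'I_m) : cventry w k = w k 0.
Proof. by rewrite /cventry valK. Qed.

Lemma cventry_out m (w : 'cV[K]_m) k : (m <= k)%N -> cventry w k = 0.
Proof. by move=> le_mk; rewrite /cventry insubF // ltnNge le_mk. Qed.

Lemma cventryN m (w : 'cV[K]_m) k : cventry (- w) k = - cventry w k.
Proof. by rewrite /cventry; case: insub => [k'|]; rewrite ?mxE ?oppr0. Qed.

Lemma truncinf_mulmx2 m (M : infmx K) (v : 'cV[K]_m) k l (a b : K) (r : 'I_m) :
  (forall c, M r c = a * (k == c)%:R + b * (l == c)%:R) ->
  (truncinf m M *m v) r 0 = a * cventry v k + b * cventry v l.
Proof.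
move=> Mr; have pick (q : nat) (x : K) :
    \sum_(c < m) x * (q == c :> nat)%:R * v c 0 = x * cventry v q.
  have [ltq|le_mq] := ltnP q m; last first.
    rewrite cventry_out // mulr0 big1 // => c _.
    by rewrite gtn_eqF ?mulr0 ?mul0r //; exact: leq_trans (ltn_ord c) le_mq.
  rewrite -[q in RHS]/(val (Ordinal ltq)) cventry_ord (bigD1 (Ordinal ltq)) //=.
  rewrite eqxx mulr1 big1 ?addr0 // => c.
  by rewrite -val_eqE /= eq_sym => /negbTE->; rewrite mulr0 mul0r.
rewrite mxE -!pick -big_split /=; apply: eq_bigr => c _.
by rewrite mxE Mr mulrDl.
Qed.

Lemma Linf_col i m (w : 'cV[K]_m) r c : c != i -> Linf i w r c = (r == c)%:R.
Proof. by rewrite /= /L_entry => /negbTE->; rewrite addr0. Qed.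

Lemma Linf_row i m (w : 'cV[K]_m) r c :
  (r <= i)%N -> Linf i w r c = (r == c)%:R.
Proof. by rewrite /= /L_entry ltnNge => ->; rewrite andbF addr0. Qed.

Lemma Linf_row2 i m (w : 'cV[K]_m) r c : (i < r)%N ->
  Linf i w r c = (r == c)%:R + cventry w (r - i.+1) * (i == c)%:R.
Proof.
move=> lt_ir; rewrite /= /L_entry lt_ir andbT [c == i]eq_sym.
by case: (i == c); rewrite ?mulr1 ?mulr0.
Qed.

(** Entrywise, row r > i of the two products gives v_r = v'_r + w_r v'_j. The
truncated vectors are compared through [cventry], which is 0 beyond their
length. *)
Lemma Linf_conj (n i j : nat) (v v' : 'cV[K]_(n - i.+1))
    (w : 'cV[K]_(n - j.+1)) :
  (i < j)%N -> (j < n)%N ->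
  (forall k : 'I_(n - i.+1), v' k 0 =
        if (i.+1 + k <= j)%N then v k 0
        else v k 0 - cventry w (i.+1 + k - j.+1) * cventry v (j - i.+1)) ->
  cventry v' (j - i.+1) = cventry v (j - i.+1) /\
  mulinf (Linf i v) (Linf j w) = mulinf (Linf j w) (Linf i v').
Proof.
move=> lt_ij lt_jn v'E.
have {v'E}v'E r : (i < r)%N -> cventry v' (r - i.+1) =
    if (r <= j)%N then cventry v (r - i.+1)
    else cventry v (r - i.+1) - cventry w (r - j.+1) * cventry v (j - i.+1).
  move=> lt_ir; have [le_nr|lt_rn] := leqP n r.
    rewrite ifF; last by lia.
    by rewrite !(@cventry_out _ _ (r - _)) ?mul0r ?subr0 //; lia.
  have ltk : (r - i.+1 < n - i.+1)%N by lia.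
  rewrite -[(r - _)%N]/(val (Ordinal ltk)) !cventry_ord v'E /=.
  by rewrite (_ : i.+1 + _ = r)%N //; lia.
have v'j : cventry v' (j - i.+1) = cventry v (j - i.+1) by rewrite v'E ?leqnn.
split=> //; apply: infmxP => r c.
have Wi d : Linf j w i d = (i == d)%:R by apply: Linf_row; exact: ltnW.
have [le_ri|lt_ir] := leqP r i.
  rewrite (mulinf_row_unit _ (k := r)) => [|d]; last exact: Linf_row.
  rewrite (mulinf_row_unit _ (k := r)) => [|d]; last by apply: Linf_row; lia.
  by rewrite !Linf_row //; lia.
rewrite (mulinf_row2 _ (k := r) (l := i) (a := 1)
    (b := cventry v (r - i.+1))) => [|d]; last by rewrite Linf_row2 // mul1r.
rewrite Wi; have [le_rj|lt_jr] := leqP r j.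
  rewrite (mulinf_row_unit _ (k := r)) => [|d]; last exact: Linf_row.
  by rewrite Linf_row // Linf_row2 // v'E // le_rj mul1r.
rewrite (mulinf_row2 _ (k := r) (l := j) (a := 1)
    (b := cventry w (r - j.+1))) => [|d]; last by rewrite Linf_row2 // mul1r.
rewrite !Linf_row2 // v'j v'E // leqNgt lt_jr /=.
ring.
Qed.
End Shears.

(** * Pure tensors and the iterated coproduct *)

Section TensorInduction.
Variables (K : fieldType) (B : comAlgType K) (T : tensor_powers B) (n : nat).
Variable P : T n -> Prop.
Hypothesis P_lin : forall a x y, P x -> P y -> P (a *: x + y).
Hypothesis P_tens : forall t, P (tens T t).

Let S : {pred T n} := fun x => `[<P x>].

Let S_submod : submod_closed S.
Proof.
have S1 : P 1 by rewrite -tens_one.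
split=> [|a x y /asboolP Px /asboolP Py]; apply/asboolP; last exact: P_lin.
by rewrite -(addNr 1) -scaleN1r; apply: P_lin.
Qed.

HB.instance Definition _ := GRing.isSubmodClosed.Build K (T n) S S_submod.

Record span := Span { span_val :> T n; _ : span_val \in S }.
HB.instance Definition _ := [isSub for span_val].
HB.instance Definition _ := [Choice of span by <:].
HB.instance Definition _ := [SubChoice_isSubLmodule of span by <:].

(** Pure tensors span. The universal property maps the tensor power linearly
into the submodule of the elements satisfying P, and by uniqueness the
composition with the inclusion is the identity. *)
Lemma tens_ind x : P x.
Proof.
have St t : tens T t \in S by apply/asboolP.
pose phi t : span := Span (St t).
have phi_ml : multilinear phi.
  by move=> t k a y z; apply: val_inj; rewrite /= (tens_multilinear T).
have lin1 := @tlift_linear _ _ T _ _ _ phi_ml.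
pose psi : {linear T n -> span} :=
  HB.pack (tlift phi) (GRing.isLinear.Build _ _ _ _ (tlift phi) lin1).
rewrite -[x]/(idfun x) (@tlift_unique _ _ T n _ idfun (val \o psi)) => [|t].
  exact/asboolP/(valP (psi x)).
by rewrite /= tlift_tens.
Qed.

End TensorInduction.

Lemma linear_scale (K : fieldType) (V W : lmodType K) (L : V -> W) :
  linear L -> forall a x, L (a *: x) = a *: L x.
Proof.
move=> linL a x; have L0 : L 0 = 0.
  by rewrite -[X in L X](addNr 0) -scaleN1r linL scaleN1r addNr.
by rewrite -[a *: x]addr0 linL L0 addr0.
Qed.

Lemma tuple2P (T : Type) (t : 2.-tuple T) : t = [tuple tnth t 0; tnth t 1].
Proof. by case: t => -[|x [|y []]] // szt; apply: val_inj. Qed.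

Section TensorPairs.
Variables (K : fieldType) (B : comAlgType K) (T : tensor_powers B).
Variable W : lmodType K.

Lemma tset2 (t : 2.-tuple B) k x :
  tset t k x = if k == 0 then [tuple x; tnth t 1] else [tuple tnth t 0; x].
Proof.
rewrite [LHS]tuple2P !tnth_mktuple.
by case: k => -[|[|]] //.
Qed.

Lemma bilinear_multilinear (phi : B -> B -> W) :
  (forall b, linear (phi^~ b)) -> (forall a, linear (phi a)) ->
  multilinear (fun t : 2.-tuple B => phi (tnth t 0) (tnth t 1)).
Proof.
move=> linl linr t k a x y; rewrite !tset2; case: (k == 0).
  exact: linl.
exact: linr.
Qed.

Lemma tens2_linearr a : linear (tens2 T a).
Proof.
move=> c x y; have := tens_multilinear T [tuple a; 0] 1 c x y.
by rewrite !tset2.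
Qed.

Lemma tens2_linearl b : linear (fun a => tens2 T a b).
Proof.
move=> c x y; have := tens_multilinear T [tuple 0; b] 0 c x y.
by rewrite !tset2.
Qed.

Lemma tens1_linear : linear (fun a => tens T [tuple a]).
Proof.
have tset1 (t : 1.-tuple B) x : tset t 0 x = [tuple x].
  by apply: eq_from_tnth => l; rewrite ord1 tnth_mktuple.
by move=> c x y; have := tens_multilinear T [tuple 0] 0 c x y; rewrite !tset1.
Qed.

Lemma tlift2_tens (phi : B -> B -> W) a b :
  (forall b, linear (phi^~ b)) -> (forall a, linear (phi a)) ->
  tlift2 phi (tens2 T a b) = phi a b.
Proof.
move=> linl linr; rewrite /tlift2 tlift_tens //.
exact: bilinear_multilinear.
Qed.

End TensorPairs.

Section TensorMapComposition.
Variables (K : fieldType) (B : comAlgType K) (T : tensor_powers B).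

Lemma tlift2_comp (V W : lmodType K) (L : V -> W) (phi : B -> B -> V)
    (x : T 2) :
  linear L -> (forall b, linear (phi^~ b)) -> (forall a, linear (phi a)) ->
  L (tlift2 phi x) = tlift2 (fun a b => L (phi a b)) x.
Proof.
move=> linL linl linr.
have linLl b : linear (fun a => L (phi a b)) by move=> c u v; rewrite linl linL.
have linLr a : linear (fun b => L (phi a b)) by move=> c u v; rewrite linr linL.
have lin1 := @tlift_linear _ _ T _ _ _ (bilinear_multilinear linl linr).
have lin2 := @tlift_linear _ _ T _ _ _ (bilinear_multilinear linLl linLr).
elim/tens_ind: x => [a x y IHx IHy|t].
  by rewrite /tlift2 lin1 lin2 linL [L (tlift _ x)]IHx [L (tlift _ y)]IHy.
by rewrite [t]tuple2P !tlift2_tens.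
Qed.

Lemma tlift2_tens2 (x : T 2) : tlift2 (tens2 T) x = x.
Proof.
have e : (fun t : 2.-tuple B => tens2 T (tnth t 0) (tnth t 1)) = tens T (n:=2).
  by apply/funext => t; rewrite {3}[t]tuple2P.
rewrite /tlift2 e; elim/tens_ind: x => [a x y IHx IHy|t].
  by rewrite (tlift_linear (@tens_multilinear _ _ T 2)) IHx IHy.
by rewrite tlift_tens //; exact: tens_multilinear.
Qed.

Lemma trcons_multilinear n b :
  multilinear (fun t : n.-tuple B => tens T [tuple of rcons t b]).
Proof.
move=> t k c x y.
have rcE z : [tuple of rcons (tset t k z) b] =
    tset [tuple of rcons t b] (widen_ord (leqnSn n) k) z.
  have sE l : tnth (tset t k z) l = if l == k then z else tnth t l.
    by rewrite tnth_mktuple.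
  apply: eq_from_tnth => l; rewrite tnth_mktuple !(tnth_nth 0).
  move: (tset t k z) sE => s sE /=; rewrite !nth_rcons !size_tuple -val_eqE /=.
  have [lt_ln|le_nl] := ltnP l n.
    by have := sE (Ordinal lt_ln); rewrite !(tnth_nth 0).
  by rewrite (gtn_eqF (leq_trans (ltn_ord k) le_nl)).
by rewrite !rcE; exact: tens_multilinear.
Qed.

Lemma trcons_tens n (t : n.-tuple B) b :
  trcons b (tens T t) = tens T [tuple of rcons t b].
Proof.
by rewrite /trcons tlift_tens //; exact: trcons_multilinear.
Qed.

Lemma trcons_linear n b : linear (@trcons _ _ T n b).
Proof. exact: tlift_linear (trcons_multilinear _). Qed.

Lemma trcons1 b : trcons b (1 : T 0) = tens T [tuple b].
Proof.
rewrite -tens_one trcons_tens; congr (tens T _).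
by rewrite (tuple0 [tuple _ | _ < 0]); apply: val_inj.
Qed.

End TensorMapComposition.

Section Bialgebra.
Variables (K : fieldType) (B : scaled_RB_bialgebra K).
Local Notation T := (bi_tpow B).

Lemma counit_scale_linear :
  (forall c : B, linear (fun a => (counit B a : K) *: c)) /\
  (forall a : B, linear (fun c : B => (counit B a : K) *: c)).
Proof.
split=> [c|a] k x y; last by rewrite scalerDr !scalerA mulrC.
by rewrite linearP scalerDl scalerA.
Qed.

Lemma iter_Delta1 (a : B) : iter_Delta 1 a = tens T [tuple a].
Proof.
have [linl linr] := counit_scale_linear.
rewrite -[X in tens _ [tuple X]](Delta_counitl a).
rewrite (tlift2_comp _ (tens1_linear T) linl linr).
rewrite /=; congr (tlift2 _ _); apply/funext => x; apply/funext => y.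
rewrite (linear_scale (@trcons_linear _ _ _ 0 y)) trcons1.
by rewrite (linear_scale (tens1_linear T)).
Qed.

Lemma iter_Delta2 (b : B) : iter_Delta 2 b = Delta B b.
Proof.
rewrite -[RHS](tlift2_tens2 (Delta B b)) [LHS]/=; congr (tlift2 _ _).
apply/funext => a; apply/funext => c.
by rewrite [X in trcons c X]iter_Delta1 trcons_tens; congr tens; apply: val_inj.
Qed.

(** Since 0^* is the counit followed by the unit, the counit axiom turns
(0^* (x) 1^* ) Delta b into 1 (x) b. *)
Lemma row_star_last (a : 'rV[K]_2) (b : B) : a 0 0 = 0 -> a 0 1 = 1 ->
  row_star a b = tens2 T 1 b.
Proof.
move=> a0 a1; have [linl linr] := counit_scale_linear.
rewrite -[X in tens2 _ _ X](Delta_counitl b).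
rewrite (tlift2_comp _ (tens2_linearr T 1) linl linr).
rewrite /row_star iter_Delta2 /tmap /tlift2; congr tlift; apply/funext => t.
rewrite [[tuple _ | _ < 2]]tuple2P !tnth_mktuple a0 a1 scaling0 scaling1 /ee.
rewrite (linear_scale (tens2_linearr T 1)).
by rewrite -(linear_scale (tens2_linearl T _)).
Qed.
End Bialgebra.

Lemma tens2_split (K : fieldType) (B : comAlgType K) (T : tensor_powers B)
    (x y : B) :
  tens T [tuple x; y] = tens T [tuple x; 1] * tens T [tuple 1; y].
Proof.
rewrite tens_mul; congr tens; rewrite [RHS]tuple2P !tnth_mktuple /=.
by rewrite /tnth /= mulr1 mul1r.
Qed.

(** * Substituted coefficients depend on two variables only *)

Section Admissible.
Variables (K : fieldType) (F : comAlgType K) (Fn : nat -> set F).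
Variable act : infmx K -> {lrmorphism F -> F}.
Variable integ : nat -> {linear F -> F}.
Hypothesis HF : RB_hierarchy Fn act integ.
Variable G : nat -> set F.

Section Induced.
Variables (B : scaled_RB_bialgebra K).
Variable iota : forall n, {lrmorphism bi_tpow B n -> F}.
Hypothesis HB : induced_by act integ G iota.
Local Notation T := (bi_tpow B).

Lemma at_var_tens1 (y : B) :
  at_var act 1 (iota 1 (tens T [tuple y])) = iota 2 (tens T [tuple 1; y]).
Proof.
rewrite /at_var (ind_act HB (N := 2)); last first.
  by move=> [|r] c // _ le2c /=; rewrite ltn_eqF.
by rewrite big_ord1 row_star_last // mxE.
Qed.

Lemma iota_tens1 (x : B) :
  iota 2 (tens T [tuple x; 1]) = iota 1 (tens T [tuple x]).
Proof.
have -> : [tuple x; 1] = [tuple of rcons [tuple x] 1] by apply: val_inj.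
exact: (ind_embed HB).
Qed.

End Induced.

(** Substituting a x_i + b x_j into h in G_1 is done in two steps: h[(a, b)]
lies in G_2 by stability, and the matrix PM then replaces x_0 by x_i and x_1 by
x_j. The second step sends each pure tensor of G_2 to the product of an element
of G_(i) and an element of G_(j). *)
Lemma Gvars_act (HG : admissible act integ Fn G) (M : infmx K) h (i j : nat)
    (a b : K) :
  G 1%N h -> (forall c, M 0%N c = a * (i == c)%:R + b * (j == c)%:R) ->
  Gvars act G [fset i; j]%fset (act M h).
Proof.
move=> Gh M0; have [[GF RBG] [B [iota HB]]] := HG.
have HGh := rbh_hierarchy RBG.
(* From row 2 on, the default value r of nth gives the identity. *)
pose P r c : K := (nth r [:: i; j] r == c)%:R.
have P_stable : exists n, eq_id_from n P.
  exists (maxn (maxn i j) 1).+1 => r c hrc; rewrite /P; congr (_%:R).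
  by case: r hrc => [|[|r]] /= hrc; rewrite ?nth_nil //; lia.
pose PM := InfMx P_stable.
pose N := diaginf (\matrix_(r < 2, c < 2)
  if r == 0 then (if c == 0 then a else b) else (r == c)%:R).
have Gu : G 2%N (act N h).
  by apply: (hier_act_stable HGh); exact: (hier_ascending HGh).
have N0 c : N 0%N c = a * (0 == c)%:R + b * (1 == c)%:R.
  rewrite /= /diag_entry; case: insubP => [r _ r0|//].
  have {r0}->: r = 0 by exact: val_inj.
  case: insubP => [[[|[|c']] ltc] // _ <-|];
    rewrite ?mxE /= ?mulr1 ?mulr0 ?addr0 ?add0r //.
  by case: c => [|[|c]] // _; rewrite !mulr0 addr0.
have -> : act M h = act PM (act N h).
  rewrite (actM HF); apply: (act_eq_rows HF (GF _ _ Gh)) => -[|r] // c _.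
  by rewrite M0 (mulinf_row2 _ N0).
move=> S [S1 SZ SM] SV.
have SP x : S (act PM (iota 2 x)).
  elim/tens_ind: x => [k x y Sx Sy|t].
    have -> : act PM (iota 2 (k *: x + y)) =
        k *: act PM (iota 2 x) + act PM (iota 2 y).
      by rewrite !linearP.
    exact: SZ.
  have G1 x : G 1%N (iota 1 (tens (bi_tpow B) [tuple x])).
    by rewrite -(ind_image HB); exists (tens (bi_tpow B) [tuple x]).
  have F1 x := GF _ _ (G1 x).
  have V k x : k \in [fset i; j]%fset ->
      S (at_var act k (iota 1 (tens (bi_tpow B) [tuple x]))).
    by move=> /SV; apply; exists (iota 1 (tens (bi_tpow B) [tuple x])).
  have iotaM x y : iota 2 (x * y) = iota 2 x * iota 2 y by exact: rmorphM.
  rewrite [t]tuple2P tens2_split iotaM act_mul.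
  rewrite (iota_tens1 HB) -(at_var_tens1 HB).
  rewrite (act_at_var HF (F1 _) (l := j)) //.
  have -> x : act PM (iota 1 (tens (bi_tpow B) [tuple x])) =
      at_var act i (iota 1 (tens (bi_tpow B) [tuple x])).
    by apply: (act_eq_rows HF (F1 _)) => -[|r] // c _; rewrite transp_row.
  by apply: SM; apply: V; rewrite !inE eqxx ?orbT.
by move: Gu; rewrite -(ind_image HB) => -[x _ <-].
Qed.

End Admissible.

(** * The exchange of two line integrals *)

Theorem proposition4p4 (K : fieldType) (charK : [pchar K] =i pred0)
  (F : comAlgType K) (Fn : nat -> set F)
  (act : infmx K -> {lrmorphism F -> F}) (integ : nat -> {linear F -> F})
  (HF : RB_hierarchy Fn act integ)
  (G : nat -> set F) (HG : admissible act integ Fn G)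
  (n : nat) (i j : 'I_n) (lt_ij : (i < j)%N)
  (v : 'cV[K]_(n - i.+1)) (w : 'cV[K]_(n - j.+1))
  (g h : F) (Gg : G 1%N g) (Gh : G 1%N h) :
  let vj := cventry v (j - i.+1) in
  let v' := truncinf (n - i.+1) (Linvinf (j - i.+1) w) *m v in
  let a : 'rV[K]_n := delta_mx 0 j - vj *: delta_mx 0 i in
  let h' := act (rowinf a) h in
  let alpha := [fset nat_of_ord i; nat_of_ord j]%fset in
  [/\ forall k : 'I_(n - i.+1), v' k 0 =
        if (i.+1 + k <= j)%N then v k 0
        else v k 0 - cventry w (i.+1 + k - j.+1) * vj,
      Gvars act G alpha h'
    & forall (r : nat) (c : nat -> 'I_r -> F),
        tensor_expansion act G alpha h' c ->
        let eta' mu := at_var act i g * c i mu in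
        let eta mu := c j mu in
        forall f : F,
          integ j (at_var act j h * act (Linf j w)
            (integ i (at_var act i g * act (Linf i v) f))) =
          (idfun \- act (evalinf K j))
            (\sum_(mu < r) integ i (eta' mu * act (Linf i v')
              (integ j (eta mu * act (Linf j w) f))))].
Proof.
move=> vj v' a h' alpha.
have aE c : rowinf a 0%N c =
    - vj * (nat_of_ord i == c)%:R + 1 * (nat_of_ord j == c)%:R.
  rewrite mul1r /= /row_entry /=; case: insubP => [c' _ <-|].
    by rewrite !mxE eqxx /= addrC mulNr ![c' == _]eq_sym.
  move=> ncn; have [lt_in lt_jn] := (ltn_ord i, ltn_ord j).
  by rewrite !ltn_eqF ?mulr0 ?addr0 //; lia.
have v'E (k : 'I_(n - i.+1)) : v' k 0 =
    if (i.+1 + k <= j)%N then v k 0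
    else v k 0 - cventry w (i.+1 + k - j.+1) * vj.
  have [le_kj|lt_jk] := leqP (i.+1 + k) j.
    rewrite (truncinf_mulmx2 _ (k := k) (l := k) (a := 1) (b := 0)) => [|d].
      by rewrite mul1r mul0r addr0 cventry_ord.
    by rewrite Linf_row ?mul1r ?mul0r ?addr0 //; lia.
  rewrite (truncinf_mulmx2 _ (k := k) (l := (j - i.+1)%N) (a := 1)
      (b := - cventry w (i.+1 + k - j.+1))) => [|d].
    by rewrite mul1r mulNr cventry_ord.
  rewrite Linf_row2 ?mul1r ?cventryN; last by lia.
  by rewrite (_ : k - _ = i.+1 + k - j.+1)%N //; lia.
split=> // [|r c [cG h'E] eta' eta f]; first exact: (Gvars_act HF HG Gh aE).
have [v'j LL] := Linf_conj lt_ij (ltn_ord j) v'E.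
have FG x : G 1%N x -> Fn 1%N x by case: HG => -[+ _] _; apply.
have ne_ij : nat_of_ord i != j by rewrite ltn_eqF.
have L'j k : Linf i v' j k =
    (nat_of_ord j == k)%:R + vj * (nat_of_ord i == k)%:R.
  by rewrite Linf_row2 // v'j.
have cE k mu : k \in alpha -> exists2 x, Fn 1%N x & c k mu = at_var act k x.
  by move=> /(cG _ mu)[x /FG Fx <-]; exists x.
have [ia ja] : nat_of_ord i \in alpha /\ nat_of_ord j \in alpha.
  by rewrite !inE !eqxx orbT.
apply: (@line_integral_exchange _ _ _ _ _ HF _ _ _ _ _ _ _ (c i) (c j)
  (at_var act i g) (at_var act j h) f ne_ij LL L'j).
- by move=> k; rewrite Linf_col // eq_sym.
- by move=> k; apply: Linf_row; exact: ltnW.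
- by move=> k; apply: Linf_col.
- apply: (act_at_var HF (FG _ Gg)) => d; apply: Linf_row; exact: ltnW.
- exact: (eval_at_var HF (FG _ Gg)).
- by apply: (eval_at_var HF (FG _ Gh)); rewrite eq_sym.
- by move=> mu; have [x Fx ->] := cE _ mu ia; exact: (eval_at_var HF).
have -> : \sum_mu c i mu * act (Linf i v') (c j mu) = act (Linf i v') h'.
  rewrite h'E linear_sum; apply: eq_bigr => mu _ /=.
  rewrite big_fsetU1 ?big_seq_fset1 ?inE //= act_mul; congr (_ * _).
  have [x Fx ->] := cE _ mu ia.
  by rewrite (act_at_var HF Fx (l := i)) // => d; apply: Linf_row.
(* The first row of the product is (e_j - v_j e_i) L_i(v') = e_j. *)
rewrite /h' (actM HF); apply: (act_eq_rows HF (FG _ Gh)) => -[|q] // d _.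
rewrite transp_row (mulinf_row2 _ aE) Linf_row // L'j.
ring.
Qed.
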